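(* There is an amalgamated free product decomposition $$SL_2(\mathbb{Z}[t,t^{-1}]) \cong SL_2(\mathbb{Z}[t]) \ast_P SL_2(\mathbb{Z}[t]).$$ Here the two factors are mapped to $SL_2(\mathbb{Z}[t,t^{-1}])$ by the inclusion $i_1$ and by the homomorphism $i_2$, respectively, and $P$ is embedded in the first factor by the inclusion $j_1$ and in the second factor by $j_2$, where $i_1,i_2,j_1,j_2$ and $P$ are as defined in the context. That is, the homomorphism from the amalgamated free product (pushout of groups) of $j_1: P\to SL_2(\mathbb{Z}[t])$ and $j_2:P\to SL_2(\mathbb{Z}[t])$ to $SL_2(\mathbb{Z}[t,t^{-1}])$ induced by $i_1$ and $i_2$ is an isomorphism.
   Context: Let $\Gamma(\mathbb{Q})$ be the subgroup of $SL_2(\mathbb{Q}[t])$ consisting of the matrices that are upper triangular modulo $t$, i.e. of the matrices $\begin{pmatrix} a & b\\ tc & d\end{pmatrix}$ of determinant $1$ with $a,b,c,d\in\mathbb{Q}[t]$. Put $P=SL_2(\mathbb{Z}[t])\cap\Gamma(\mathbb{Q})$. The map $i_1: SL_2(\mathbb{Z}[t])\to SL_2(\mathbb{Z}[t,t^{-1}])$ is the inclusion, and $i_2: SL_2(\mathbb{Z}[t])\to SL_2(\mathbb{Z}[t,t^{-1}])$ is the injective homomorphism $$i_2(A)=\begin{pmatrix}1&0\\0&t\end{pmatrix}A\begin{pmatrix}1&0\\0&t^{-1}\end{pmatrix}.$$ The map $j_1:P\to SL_2(\mathbb{Z}[t])$ is the inclusion, and $j_2:P\to SL_2(\mathbb{Z}[t])$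 is the injective homomorphism $$j_2(A)=\begin{pmatrix}1&0\\0&t^{-1}\end{pmatrix}A\begin{pmatrix}1&0\\0&t\end{pmatrix},$$ so that $i_1\circ j_1=i_2\circ j_2$ is the inclusion of $P$ into $SL_2(\mathbb{Z}[t,t^{-1}])$. *)

(* Defs.v *)
From HB Require Import structures.
From mathcomp Require Import all_boot all_order all_algebra.
From mathcomp Require Import generic_quotient boolp.

Set Implicit Arguments.
Unset Strict Implicit.
Unset Printing Implicit Defensive.

Import GRing.Theory.
Local Open Scope ring_scope.

Section AmalgamatedProduct.
Variables P A B : groupType.
Variables (j1 : {multiplicative P -> A}) (j2 : {multiplicative P -> B}).

Definition amalg_word : Type := seq (A + B).

(* The congruence on words generated by the group laws of A and B and by the
   identification of j1 p with j2 p. *)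
Inductive amalg_eqv : amalg_word -> amalg_word -> Prop :=
| amalg_refl w : amalg_eqv w w
| amalg_sym v w : amalg_eqv v w -> amalg_eqv w v
| amalg_trans v u w : amalg_eqv v u -> amalg_eqv u w -> amalg_eqv v w
| amalg_cat v v' w w' :
    amalg_eqv v v' -> amalg_eqv w w' -> amalg_eqv (v ++ w) (v' ++ w')
| amalg_1l : amalg_eqv [:: inl 1%g] [::]
| amalg_1r : amalg_eqv [:: inr 1%g] [::]
| amalg_Ml a a' : amalg_eqv [:: inl a; inl a'] [:: inl (a * a')%g]
| amalg_Mr b b' : amalg_eqv [:: inr b; inr b'] [:: inr (b * b')%g]
| amalg_glue p : amalg_eqv [:: inl (j1 p)] [:: inr (j2 p)].

Definition amalg_eqvb : rel amalg_word := fun v w => `[< amalg_eqv v w >].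

Lemma amalg_eqvb_equiv : equiv_class_of amalg_eqvb.
Proof.
split=> [w|v w|u v w]; first exact/asboolP/amalg_refl.
  by apply/asboolP/asboolP; apply: amalg_sym.
by move=> /asboolP uv /asboolP vw; apply/asboolP/(amalg_trans uv).
Qed.
Canonical amalg_equiv := EquivRelPack amalg_eqvb_equiv.

Definition amalg := {eq_quot amalg_equiv}%qT.
HB.instance Definition _ := Choice.on amalg.

Definition amalg_pi (w : amalg_word) : amalg := (\pi_amalg w)%qT.
Definition amalg_repr (x : amalg) : amalg_word := repr x.

Lemma amalg_reprK : cancel amalg_repr amalg_pi.
Proof. exact: reprK. Qed.

Lemma amalg_piP v w : amalg_pi v = amalg_pi w <-> amalg_eqv v w.
Proof. by split=> [/eqmodP/asboolP|vw]; last exact/eqmodP/asboolP. Qed.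

Lemma amalg_piK w : amalg_eqv (amalg_repr (amalg_pi w)) w.
Proof. exact/amalg_piP/amalg_reprK. Qed.

Definition amalg_one : amalg := amalg_pi [::].
Definition amalg_mul (x y : amalg) : amalg :=
  amalg_pi (amalg_repr x ++ amalg_repr y).
Definition letter_inv (l : A + B) : A + B :=
  match l with inl a => inl a^-1%g | inr b => inr b^-1%g end.
Definition word_inv (w : amalg_word) : amalg_word := rev (map letter_inv w).
Definition amalg_inv (x : amalg) : amalg := amalg_pi (word_inv (amalg_repr x)).

Lemma amalg_mulE v w :
  amalg_mul (amalg_pi v) (amalg_pi w) = amalg_pi (v ++ w).
Proof. by apply/amalg_piP/amalg_cat; apply: amalg_piK. Qed.

Lemma amalg_mulA : associative amalg_mul.
Proof.
move=> x y z; rewrite -(amalg_reprK x) -(amalg_reprK y) -(amalg_reprK z).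
by rewrite !amalg_mulE catA.
Qed.

Lemma amalg_mul1 : left_id amalg_one amalg_mul.
Proof. by move=> x; rewrite -(amalg_reprK x) amalg_mulE. Qed.

Lemma amalg_mulr1 : right_id amalg_one amalg_mul.
Proof. by move=> x; rewrite -(amalg_reprK x) amalg_mulE cats0. Qed.

Lemma amalg_letterVl l : amalg_eqv [:: letter_inv l; l] [::].
Proof.
case: l => [a|b].
  by apply: amalg_trans (amalg_Ml _ _) _; rewrite mulVg; apply: amalg_1l.
by apply: amalg_trans (amalg_Mr _ _) _; rewrite mulVg; apply: amalg_1r.
Qed.

Lemma letter_invK : involutive letter_inv.
Proof. by case=> x /=; rewrite invgK. Qed.

Lemma word_invK : involutive word_inv.
Proof. by move=> w; rewrite /word_inv map_rev revK mapK //; apply: letter_invK. Qed.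

Lemma amalg_wordVl w : amalg_eqv (word_inv w ++ w) [::].
Proof.
elim: w => [|l w IHw]; first exact: amalg_refl.
rewrite /word_inv /= rev_cons cat_rcons -cat1s catA -[l :: w]cat1s.
apply: amalg_trans IHw; rewrite -catA -/(word_inv w).
apply: amalg_cat; first exact: amalg_refl.
rewrite catA -[X in amalg_eqv _ X]cat0s.
by apply: amalg_cat; [apply: amalg_letterVl | apply: amalg_refl].
Qed.

Lemma amalg_mulV : left_inverse amalg_one amalg_inv amalg_mul.
Proof.
move=> x; rewrite -{2}(amalg_reprK x) amalg_mulE.
exact/amalg_piP/amalg_wordVl.
Qed.

Lemma amalg_mulrV : right_inverse amalg_one amalg_inv amalg_mul.
Proof.
move=> x; rewrite -{1}(amalg_reprK x) amalg_mulE; apply/amalg_piP.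
by rewrite -{1}(word_invK (amalg_repr x)); apply: amalg_wordVl.
Qed.

HB.instance Definition _ := isGroup.Build amalg
  amalg_mulA amalg_mul1 amalg_mulr1 amalg_mulV amalg_mulrV.

Definition amalg_inl (a : A) : amalg := amalg_pi [:: inl a].
Definition amalg_inr (b : B) : amalg := amalg_pi [:: inr b].

Lemma amalg_inlM : {morph amalg_inl : x y / (x * y)%g}.
Proof.
by move=> x y; rewrite [RHS]amalg_mulE; apply/amalg_piP/amalg_sym/amalg_Ml.
Qed.
HB.instance Definition _ := isMultiplicative.Build A amalg amalg_inl amalg_inlM.

Lemma amalg_inrM : {morph amalg_inr : x y / (x * y)%g}.
Proof.
by move=> x y; rewrite [RHS]amalg_mulE; apply/amalg_piP/amalg_sym/amalg_Mr.
Qed.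
HB.instance Definition _ := isMultiplicative.Build B amalg amalg_inr amalg_inrM.

Lemma amalg_inlr p : amalg_inl (j1 p) = amalg_inr (j2 p).
Proof. exact/amalg_piP/amalg_glue. Qed.

End AmalgamatedProduct.

Section UniversalProperty.
Variables P A B G : groupType.
Variables (j1 : {multiplicative P -> A}) (j2 : {multiplicative P -> B}).
Variables (f : {multiplicative A -> G}) (g : {multiplicative B -> G}).

Definition letter_eval (l : A + B) : G :=
  match l with inl a => f a | inr b => g b end.
Definition word_eval (w : amalg_word A B) : G :=
  foldr (fun l x => letter_eval l * x)%g 1%g w.

Lemma word_eval_cat v w : word_eval (v ++ w) = (word_eval v * word_eval w)%g.
Proof. by elim: v => [|l v IHv] /=; rewrite ?mul1g // IHv mulgA. Qed.

Lemma multiplicative1 (H K : groupType) (h : {multiplicative H -> K}) :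
  h 1%g = 1%g.
Proof. by apply: (mulgI (h 1%g)); rewrite -gmulfM !mulg1. Qed.

Hypothesis fg : f \o j1 =1 g \o j2.

Lemma word_eval_eqv v w : amalg_eqv j1 j2 v w -> word_eval v = word_eval w.
Proof.
elim=> //= {v w}.
- by move=> v u w _ -> _ ->.
- by move=> v v' w w' _ IHv _ IHw; rewrite !word_eval_cat IHv IHw.
- by rewrite multiplicative1 mulg1.
- by rewrite multiplicative1 mulg1.
- by move=> a a'; rewrite gmulfM !mulg1.
- by move=> b b'; rewrite gmulfM !mulg1.
- by move=> p; rewrite !mulg1; apply: fg.
Qed.

Definition amalg_lift of f \o j1 =1 g \o j2 : amalg j1 j2 -> G :=
  fun x => word_eval (amalg_repr x).

Lemma amalg_lift_pi w : amalg_lift fg (amalg_pi j1 j2 w) = word_eval w.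
Proof. exact/word_eval_eqv/amalg_piK. Qed.

Lemma amalg_liftM : {morph amalg_lift fg : x y / (x * y)%g}.
Proof. by move=> x y; rewrite [LHS]amalg_lift_pi word_eval_cat. Qed.
HB.instance Definition _ :=
  isMultiplicative.Build (amalg j1 j2) G (amalg_lift fg) amalg_liftM.

Lemma amalg_lift_inl a : amalg_lift fg (amalg_inl j1 j2 a) = f a.
Proof. by rewrite amalg_lift_pi /= mulg1. Qed.

Lemma amalg_lift_inr b : amalg_lift fg (amalg_inr j1 j2 b) = g b.
Proof. by rewrite amalg_lift_pi /= mulg1. Qed.

Lemma amalg_lift_unique (h : {multiplicative amalg j1 j2 -> G}) :
  h \o amalg_inl j1 j2 =1 f -> h \o amalg_inr j1 j2 =1 g ->
  h =1 amalg_lift fg.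
Proof.
move=> hf hg x; rewrite -(amalg_reprK x) amalg_lift_pi.
elim: (amalg_repr x) => [|l w IHw] /=; first exact: multiplicative1.
have -> : amalg_pi j1 j2 (l :: w) =
          (amalg_pi j1 j2 [:: l] * amalg_pi j1 j2 w)%g.
  by rewrite [RHS]amalg_mulE.
by rewrite gmulfM IHw; congr (_ * _)%g; case: l => [a|b]; [apply: hf | apply: hg].
Qed.

End UniversalProperty.

Record SL (n : nat) (R : comNzRingType) : Type :=
  MkSL { SL_mx :> 'M[R]_n; _ : \det SL_mx == 1 }.
HB.instance Definition _ n R := [isSub for @SL_mx n R].
HB.instance Definition _ n R := [Choice of SL n R by <:].

Section SpecialLinear.
Variables (n : nat) (R : comNzRingType).
Implicit Types A B : SL n R.

Lemma SL_det A : \det A = 1.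
Proof. exact/eqP/(valP A). Qed.

Lemma SL_one_subproof : \det (1%:M : 'M[R]_n) == 1.
Proof. by rewrite det1. Qed.
Lemma SL_mul_subproof A B : \det (A *m B) == 1.
Proof. by rewrite det_mulmx !SL_det mulr1. Qed.
Lemma SL_inv_subproof A : \det (\adj A) == 1.
Proof.
have: \det (A *m \adj A) = 1 by rewrite mul_mx_adj SL_det det1.
by rewrite det_mulmx SL_det mul1r => ->.
Qed.

Definition SL_one := MkSL SL_one_subproof.
Definition SL_mul A B := MkSL (SL_mul_subproof A B).
Definition SL_inv A := MkSL (SL_inv_subproof A).

Lemma SL_mulA : associative SL_mul.
Proof. by move=> A B C; apply/val_inj/mulmxA. Qed.
Lemma SL_mul1 : left_id SL_one SL_mul.
Proof. by move=> A; apply/val_inj/mul1mx. Qed.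
Lemma SL_mulr1 : right_id SL_one SL_mul.
Proof. by move=> A; apply/val_inj/mulmx1. Qed.
Lemma SL_mulV : left_inverse SL_one SL_inv SL_mul.
Proof. by move=> A; apply/val_inj; rewrite /= mul_adj_mx SL_det. Qed.
Lemma SL_mulrV : right_inverse SL_one SL_inv SL_mul.
Proof. by move=> A; apply/val_inj; rewrite /= mul_mx_adj SL_det. Qed.

HB.instance Definition _ := isGroup.Build (SL n R)
  SL_mulA SL_mul1 SL_mulr1 SL_mulV SL_mulrV.

End SpecialLinear.

Section SLmap.
Variables (n : nat) (R S : comNzRingType) (f : {rmorphism R -> S}).

Lemma SL_map_subproof (A : SL n R) : \det (map_mx f A) == 1.
Proof. by rewrite det_map_mx SL_det rmorph1. Qed.
Definition SL_map (A : SL n R) : SL n S := MkSL (SL_map_subproof A).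

Lemma SL_mapM : {morph SL_map : A B / (A * B)%g}.
Proof. by move=> A B; apply/val_inj; rewrite /= map_mxM. Qed.
HB.instance Definition _ :=
  isMultiplicative.Build (SL n R) (SL n S) SL_map SL_mapM.
End SLmap.

Definition diag1 (R : comNzRingType) (u : R) : 'M[R]_2 :=
  diag_mx (\row_(j < 2) if j == 0 then 1 else u).

Lemma det_diag1 (R : comNzRingType) (u : R) : \det (diag1 u) = u.
Proof. by rewrite det_diag !big_ord_recl big_ord0 !mxE /= mulr1 mul1r. Qed.

Lemma diag1M (R : comNzRingType) (u v : R) : diag1 u *m diag1 v = diag1 (u * v).
Proof.
rewrite /diag1 mulmx_diag; congr diag_mx; apply/rowP=> j; rewrite !mxE.
by case: eqP; rewrite ?mulr1.
Qed.

Lemma diag1_1 (R : comNzRingType) : diag1 1 = 1%:M :> 'M[R]_2.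
Proof.
rewrite -diag_const_mx; congr diag_mx; apply/rowP=> j; rewrite !mxE.
by case: eqP.
Qed.

Section Conjugation.
Variables (R : comNzRingType) (u v : R).

Lemma SL_conj_subproof (uv : u * v = 1) (A : SL 2 R) :
  \det (diag1 u *m A *m diag1 v) == 1.
Proof. by rewrite !det_mulmx SL_det mulr1 !det_diag1 uv. Qed.

Definition SL_conj (uv : u * v = 1) (A : SL 2 R) : SL 2 R :=
  MkSL (SL_conj_subproof uv A).

Lemma SL_conjM (uv : u * v = 1) : {morph SL_conj uv : A B / (A * B)%g}.
Proof.
move=> A B; apply/val_inj; rewrite /= !mulmxA; congr (_ *m _ *m _).
by rewrite -[RHS]mulmxA diag1M mulrC uv diag1_1 mulmx1.
Qed.
HB.instance Definition _ (uv : u * v = 1) :=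
  isMultiplicative.Build (SL 2 R) (SL 2 R) (SL_conj uv) (SL_conjM uv).

End Conjugation.

Lemma SL_conjK (R : comNzRingType) (u v : R) (uv : u * v = 1) (vu : v * u = 1) :
  cancel (SL_conj uv) (SL_conj vu).
Proof.
move=> A; apply/val_inj; rewrite /= !mulmxA diag1M vu -!mulmxA diag1M vu.
by rewrite diag1_1 mul1mx mulmx1.
Qed.

(* R[t, t^-1] as the subring of the fractions p / t^k inside Frac(R[t]). *)
Section Laurent.
Variable R : idomainType.

Definition is_laurent : {pred {fraction {poly R}}} :=
  fun x => `[< exists (p : {poly R}) k, x = tofrac p / tofrac 'X ^+ k >].

Record laurent : Type := MkLaurent {
  laurent_val :> {fraction {poly R}}; _ : laurent_val \in is_laurent }.
HB.instance Definition _ := [isSub for laurent_val].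
HB.instance Definition _ := [Choice of laurent by <:].

Lemma tofracX_neq0 : tofrac ('X : {poly R}) != 0.
Proof. by rewrite tofrac_eq0 polyX_eq0. Qed.

Lemma is_laurent_closed : subring_closed is_laurent.
Proof.
have X0 k : tofrac ('X : {poly R}) ^+ k != 0 by rewrite expf_neq0 ?tofracX_neq0.
split=> [|x y /asboolP[p [k ->]] /asboolP[q [l ->]]|
          x y /asboolP[p [k ->]] /asboolP[q [l ->]]]; apply/asboolP.
- by exists 1, 0; rewrite expr0 divr1 rmorph1.
- exists (p * 'X^l - q * 'X^k), (k + l).
  rewrite rmorphB !rmorphM !rmorphXn /= exprD.
  by rewrite -[- (_ / _)]mulNr addf_div // mulNr.
- by exists (p * q), (k + l); rewrite rmorphM /= exprD mulf_div.
Qed.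
HB.instance Definition _ :=
  GRing.SubChoice_isSubComNzRing.Build _ is_laurent laurent is_laurent_closed.

Lemma laurent_poly_subproof (p : {poly R}) : tofrac p \in is_laurent.
Proof. by apply/asboolP; exists p, 0; rewrite expr0 divr1. Qed.
Definition laurent_poly (p : {poly R}) : laurent :=
  MkLaurent (laurent_poly_subproof p).

Lemma laurent_poly_zmod_morphism : zmod_morphism laurent_poly.
Proof. by move=> p q; apply/val_inj; rewrite /= rmorphB. Qed.
HB.instance Definition _ := GRing.isZmodMorphism.Build {poly R} laurent
  laurent_poly laurent_poly_zmod_morphism.
Lemma laurent_poly_monoid_morphism : monoid_morphism laurent_poly.
Proof. by split=> [|p q]; apply/val_inj; rewrite /= ?rmorph1 ?rmorphM. Qed.
HB.instance Definition _ := GRing.isMonoidMorphism.Build {poly R} laurent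
  laurent_poly laurent_poly_monoid_morphism.

Lemma laurent_poly_inj : injective laurent_poly.
Proof. by move=> p q [/eqP]; rewrite tofrac_eq => /eqP. Qed.

Definition laurent_t : laurent := laurent_poly 'X.

Lemma laurent_tV_subproof : (tofrac ('X : {poly R}))^-1 \in is_laurent.
Proof. by apply/asboolP; exists 1, 1; rewrite rmorph1 expr1 div1r. Qed.
Definition laurent_tV : laurent := MkLaurent laurent_tV_subproof.

Lemma laurent_tVr : laurent_t * laurent_tV = 1.
Proof. by apply/val_inj; rewrite /= divff // tofracX_neq0. Qed.
Lemma laurent_tVl : laurent_tV * laurent_t = 1.
Proof. by rewrite mulrC laurent_tVr. Qed.

End Laurent.

Notation SL2Zt := (SL 2 {poly int}).
Notation SL2Qt := (SL 2 {poly rat}).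
Notation SL2Ztt := (SL 2 (laurent int)).

Definition SL2Zt_Qt : SL2Zt -> SL2Qt :=
  SL_map (map_poly (intr : int -> rat)).
Lemma SL2Zt_QtM : {morph SL2Zt_Qt : A B / (A * B)%g}.
Proof. exact: SL_mapM. Qed.
HB.instance Definition _ :=
  isMultiplicative.Build SL2Zt SL2Qt SL2Zt_Qt SL2Zt_QtM.

(* Gamma(Q): the matrices that are upper triangular modulo t. *)
Definition GammaQ : {pred SL2Qt} := fun A => 'X %| SL_mx A 1 0.

Lemma SL2_mulE10 (R : comNzRingType) (A B : SL 2 R) :
  SL_mx (A * B)%g 1 0 = SL_mx A 1 0 * SL_mx B 0 0 + SL_mx A 1 1 * SL_mx B 1 0.
Proof.
rewrite mxE !big_ord_recl big_ord0 addr0.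
by have -> : lift ord0 ord0 = 1 :> 'I_2 by apply/val_inj.
Qed.

Lemma SL2_invE10 (R : comNzRingType) (A : SL 2 R) :
  SL_mx A^-1%g 1 0 = - SL_mx A 1 0.
Proof.
rewrite /= mxE /cofactor det_mx11 !mxE /= expr1 mulN1r.
by congr (- SL_mx A _ _); apply/val_inj.
Qed.

Lemma GammaQ_closed : group_closed GammaQ.
Proof.
split=> [|A B GA GB]; rewrite unfold_in /GammaQ; first by rewrite mxE dvdp0.
rewrite SL2_mulE10 SL2_invE10; apply: dvdp_add; first exact: dvdp_mulr.
by apply: dvdp_mull; rewrite dvdpNr.
Qed.
HB.instance Definition _ :=
  isMulClosed.Build _ GammaQ (group_closedM GammaQ_closed).
HB.instance Definition _ := isMul1Closed.Build _ GammaQ GammaQ_closed.1.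
HB.instance Definition _ :=
  isInvClosed.Build _ GammaQ (group_closedV GammaQ_closed).

(* P = SL_2(Z[t]) \cap Gamma(Q), the intersection being taken in SL_2(Q[t]). *)
Definition in_Pgrp : {pred SL2Zt} := fun A => SL2Zt_Qt A \in GammaQ.

Lemma in_Pgrp_closed : group_closed in_Pgrp.
Proof.
split=> [|A B PA PB]; rewrite unfold_in /in_Pgrp.
  by rewrite (multiplicative1 SL2Zt_Qt) gpred1.
have -> : SL2Zt_Qt (A / B)%g = (SL2Zt_Qt A / SL2Zt_Qt B)%g.
  apply: (mulIg (SL2Zt_Qt B)); rewrite -gmulfM.
  by rewrite !mulgVK.
exact: gpredF.
Qed.

Record Pgrp : Type := MkPgrp { Pgrp_val :> SL2Zt; _ : Pgrp_val \in in_Pgrp }.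
HB.instance Definition _ := [isSub for Pgrp_val].
HB.instance Definition _ := [Choice of Pgrp by <:].
HB.instance Definition _ :=
  SubChoice_isSubGroup.Build _ in_Pgrp Pgrp in_Pgrp_closed.

Definition i1 : SL2Zt -> SL2Ztt := SL_map (@laurent_poly int).
Lemma i1M : {morph i1 : A B / (A * B)%g}.
Proof. exact: SL_mapM. Qed.
HB.instance Definition _ := isMultiplicative.Build SL2Zt SL2Ztt i1 i1M.

Definition i2 : SL2Zt -> SL2Ztt := SL_conj (laurent_tVr int) \o i1.
Lemma i2M : {morph i2 : A B / (A * B)%g}.
Proof. by move=> A B; rewrite /i2 /= i1M SL_conjM. Qed.
HB.instance Definition _ := isMultiplicative.Build SL2Zt SL2Ztt i2 i2M.

Definition j1 : Pgrp -> SL2Zt := Pgrp_val.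
Lemma j1M : {morph j1 : A B / (A * B)%g}.
Proof. by []. Qed.
HB.instance Definition _ := isMultiplicative.Build Pgrp SL2Zt j1 j1M.

Lemma i1_inj : injective i1.
Proof.
move=> A B /(congr1 val)/= AB; apply/val_inj/matrixP=> i j.
by apply: laurent_poly_inj; move/matrixP: AB => /(_ i j); rewrite !mxE.
Qed.

Lemma i2_inj : injective i2.
Proof.
by apply: inj_comp i1_inj; apply: can_inj (SL_conjK _ (laurent_tVl int)).
Qed.

Lemma j1_inj : injective j1.
Proof. exact: val_inj. Qed.

(* For A in P, diag(1, t^-1) A diag(1, t) has entries in Z[t]; j2 A is that
   matrix, read in SL_2(Z[t]) (unique since i1 is injective). *)
Lemma j2_subproof (A : Pgrp) :
  exists B : SL2Zt, i1 B = SL_conj (laurent_tVl int) (i1 (j1 A)).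
Proof.
have [q Aq] : exists q, SL_mx (j1 A) 1 0 = q * 'X.
  have: root (SL_mx (SL2Zt_Qt (j1 A)) 1 0) 0.
    by rewrite -dvdp_XsubCl subr0; apply: (valP A).
  rewrite mxE /root horner_coef0 coef_map intr_eq0 -horner_coef0 => r.
  by have [q ->] := factor_theorem _ _ r; exists q; rewrite subr0.
pose M : 'M[{poly int}]_2 := \matrix_(i, j)
  if i == 0 then if j == 0 then SL_mx (j1 A) 0 0 else SL_mx (j1 A) 0 1 * 'X
  else if j == 0 then q else SL_mx (j1 A) 1 1.
have ME : map_mx (@laurent_poly int) M =
          SL_mx (SL_conj (laurent_tVl int) (i1 (j1 A))).
  have I2 (i : 'I_2) : i = 0 \/ i = 1.
    by case: i => [[|[|//]]] i; [left | right]; apply/val_inj.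
  apply/matrixP=> i j; rewrite /= /diag1 mul_diag_mx mul_mx_diag !mxE.
  have tV_t : laurent_tV int * laurent_poly 'X = 1 := laurent_tVl int.
  case: (I2 i) => ->; case: (I2 j) => -> /=; rewrite ?mul1r ?mulr1 //.
  - by rewrite rmorphM.
  - by rewrite Aq rmorphM /= mulrCA tV_t mulr1.
  - by rewrite mulrAC tV_t mul1r.
have detM : \det M == 1.
  rewrite -(inj_eq (@laurent_poly_inj int)) -det_map_mx ME SL_det.
  by rewrite rmorph1.
by exists (MkSL detM); apply/val_inj; exact: ME.
Qed.

Definition j2 (A : Pgrp) : SL2Zt := sval (cid (j2_subproof A)).

Lemma j2E A : i1 (j2 A) = SL_conj (laurent_tVl int) (i1 (j1 A)).
Proof. exact: svalP (cid (j2_subproof A)). Qed.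

Lemma j2M : {morph j2 : A B / (A * B)%g}.
Proof.
move=> A B; apply: i1_inj; rewrite [RHS]i1M !j2E.
by rewrite -[RHS]SL_conjM -[in RHS]i1M -[in RHS]j1M.
Qed.
HB.instance Definition _ := isMultiplicative.Build Pgrp SL2Zt j2 j2M.

Lemma j2_inj : injective j2.
Proof.
move=> A B /(congr1 i1); rewrite !j2E.
by move/(can_inj (SL_conjK _ (laurent_tVr int)))/i1_inj/j1_inj.
Qed.

Lemma ij_comm : i1 \o j1 =1 i2 \o j2.
Proof. by move=> A; rewrite /= /i2 /= j2E SL_conjK. Qed.

(* Main.v *)
(* Every element of an amalgam is in the image of P or is a nonempty product of
   letters outside P, alternating between the factors.

   Injectivity.  Such a product is not the identity, by ping-pong on column vectors,
   on which the t-adic valuation measures progress: a letter of the first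
   factor outside P moves vectors dominated by their top entry to vectors whose
   bottom entry has the least valuation, without changing that valuation, and
   a letter of the second factor outside P moves them back while lowering the
   valuation by one.

   Surjectivity.  Let g = t^-k G with G a polynomial matrix and k > 0.  As det G
   vanishes at t = 0, the integer matrix G(0) is singular, so an element of SL_2(Z)
   makes its bottom row vanish; i.e. S1 G = diag(1,t) G1.  Again det G1 vanishes
   at 0, and S2 G1 = diag(t,1) G2.  Hence i2(S2) i1(S1) g = t^-(k-1) G2.  These are
   the edge-transitivity and distance arguments on the Bruhat-Tits tree at t, made
   to work over Z because SL_2(Z) acts transitively on the projective line over Q. *)

Require Import Defs.
From mathcomp Require Import all_boot all_algebra boolp ring.

Set Implicit Arguments.
Unset Strict Implicit.
Unset Printing Implicit Defensive.

Import GRing.Theory.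
Local Open Scope ring_scope.

(** * Normal forms in amalgamated products *)

Section NormalForm.
Variables P A B : groupType.
Variables (j1 : {multiplicative P -> A}) (j2 : {multiplicative P -> B}).
Local Notation "<| w |>" := (amalg_pi j1 j2 w) (at level 0, format "<| w |>").

Definition is_inl (l : A + B) : bool := if l is inl _ then true else false.

Definition in_base (l : A + B) : Prop :=
  match l with
  | inl a => exists p, a = j1 p
  | inr b => exists p, b = j2 p
  end.

Fixpoint reduced (w : amalg_word A B) : Prop :=
  if w is l :: w' then
    [/\ ~ in_base l, (if w' is l' :: _ then is_inl l != is_inl l' else true)
      & reduced w']
  else True.

Lemma amalg_pi_cons l w : <|l :: w|> = (<|[:: l]|> * <|w|>)%g.
Proof. by rewrite [RHS]amalg_mulE. Qed.

Lemma in_base_pi l : in_base l -> exists p, <|[:: l]|> = amalg_inl j1 j2 (j1 p).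
Proof. by case: l => c [p ->]; exists p; rewrite // amalg_inlr. Qed.

Lemma amalg_pi_merge l l' : is_inl l = is_inl l' ->
  exists2 l'', is_inl l'' = is_inl l & <|[:: l; l']|> = <|[:: l'']|>.
Proof.
case: l l' => [a|b] [a'|b'] //= _.
  by exists (inl (a * a')%g) => //; apply/amalg_piP/amalg_Ml.
by exists (inr (b * b')%g) => //; apply/amalg_piP/amalg_Mr.
Qed.

(** The image of P is a subgroup of each factor, so absorbing one of its elements keeps a letter
    outside; the gluing relation lets either factor absorb it. *)
Lemma base_mul p l : ~ in_base l ->
  exists l', [/\ ~ in_base l', is_inl l' = is_inl l
    & (amalg_inl j1 j2 (j1 p) * <|[:: l]|>)%g = <|[:: l']|>].
Proof.
case: l => [a|b] nl.
  exists (inl (j1 p * a)%g); split=> //; last exact: (esym (amalg_inlM _ _ _ _)).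
  by case=> q pq; apply: nl; exists (p^-1 * q)%g; rewrite gmulfM -pq mulgA -gmulfM
    mulVg multiplicative1 mul1g.
exists (inr (j2 p * b)%g); split=> //; last first.
  by rewrite amalg_inlr; exact: (esym (amalg_inrM _ _ _ _)).
by case=> q pq; apply: nl; exists (p^-1 * q)%g; rewrite gmulfM -pq mulgA -gmulfM
  mulVg multiplicative1 mul1g.
Qed.

Lemma mul_base p l : ~ in_base l ->
  exists l', [/\ ~ in_base l', is_inl l' = is_inl l
    & (<|[:: l]|> * amalg_inl j1 j2 (j1 p))%g = <|[:: l']|>].
Proof.
case: l => [a|b] nl.
  exists (inl (a * j1 p)%g); split=> //; last exact: (esym (amalg_inlM _ _ _ _)).
  by case=> q pq; apply: nl; exists (q * p^-1)%g; rewrite gmulfM -pq -mulgA -gmulfM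
    mulgV multiplicative1 mulg1.
exists (inr (b * j2 p)%g); split=> //; last first.
  by rewrite amalg_inlr; exact: (esym (amalg_inrM _ _ _ _)).
by case=> q pq; apply: nl; exists (q * p^-1)%g; rewrite gmulfM -pq -mulgA -gmulfM
  mulgV multiplicative1 mulg1.
Qed.

(** Induction on the word. A new letter in P is absorbed by the tail; one from the same factor as
    the head merges with it, and a product falling into P is absorbed by the rest. *)
Lemma amalg_normal_form (x : amalg j1 j2) :
  (exists p, x = amalg_inl j1 j2 (j1 p)) \/
  (exists l w, reduced (l :: w) /\ x = <|l :: w|>).
Proof.
have baseM p l w : reduced (l :: w) -> exists l' w', reduced (l' :: w') /\
    (amalg_inl j1 j2 (j1 p) * <|l :: w|>)%g = <|l' :: w'|>.
  move=> [nl alt rw]; have [l' [nl' sl' e]] := base_mul p nl.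
  exists l', w; split; first by split=> //; rewrite sl'.
  by rewrite amalg_pi_cons mulgA e -amalg_pi_cons.
rewrite -(amalg_reprK x); elim: (amalg_repr x) => {x} [|l w IH].
  left; exists 1%g.
  by rewrite (multiplicative1 j1) (multiplicative1 (amalg_inl j1 j2)).
rewrite amalg_pi_cons; have [/in_base_pi[p ->]|nl] := pselect (in_base l).
  case: IH => [[q ->]|[l' [w' [rw ->]]]]; last by right; apply: baseM.
  by left; exists (p * q)%g; rewrite -amalg_inlM -gmulfM.
case: IH => [[q ->]|[l' [w' [rw ->]]]].
  by right; have [l' [nl' _ ->]] := mul_base q nl; exists l', [::].
have [sl|sl] := eqVneq (is_inl l) (is_inl l'); last first.
  by right; exists l, (l' :: w'); rewrite -amalg_pi_cons; split.
have [l3 sl3 e] := amalg_pi_merge sl.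
have {e}-> : (<|[:: l]|> * <|l' :: w'|>)%g = (<|[:: l3]|> * <|w'|>)%g.
  by rewrite (amalg_pi_cons l') mulgA -(amalg_pi_cons l [:: l']) e.
have [nl' alt rw'] := rw.
have [/in_base_pi[p ->]|nl3] := pselect (in_base l3).
  case: w' alt rw' {rw} => [|l4 w4] alt rw4; last by right; apply: baseM.
  by left; exists p; rewrite [LHS]mulg1.
right; exists l3, w'; rewrite -amalg_pi_cons; split=> //.
by split; rewrite // sl3 sl.
Qed.

Lemma amalg_lift_inj (G : groupType) (f : {multiplicative A -> G})
    (g : {multiplicative B -> G}) (fg : f \o j1 =1 g \o j2) :
    injective (f \o j1) ->
    (forall l w, reduced (l :: w) -> word_eval f g (l :: w) <> 1%g) ->
  injective (amalg_lift fg).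
Proof.
move=> fj_inj nred x y exy.
have : amalg_lift fg (x * y^-1)%g = 1%g.
  by apply: (mulIg (amalg_lift fg y)); rewrite -gmulfM mulgVK mul1g.
case: (amalg_normal_form (x * y^-1)%g) => [[p e]|[l [w [rw e]]]].
  rewrite e amalg_lift_inl -(multiplicative1 f) -(multiplicative1 j1).
  move=> /fj_inj p1; rewrite -[x](mulgVK y) e p1.
  by rewrite (multiplicative1 j1) (multiplicative1 (amalg_inl j1 j2)) mul1g.
by rewrite e amalg_lift_pi => /nred-/(_ rw).
Qed.

End NormalForm.

Lemma multiplicativeVK (G H : groupType) (f : {multiplicative G -> H}) x y :
  (f x^-1 * (f x * y))%g = y.
Proof. by rewrite mulgA -gmulfM mulVg multiplicative1 mul1g. Qed.

(** * Two by two matrices *)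

Lemma ord2P (i : 'I_2) : i = 0 \/ i = 1.
Proof. by case: i => [[|[|//]]] i; [left | right]; apply/val_inj. Qed.

Lemma mulmx2E (R : pzRingType) m n (A : 'M[R]_(m, 2)) (B : 'M[R]_(2, n)) i j :
  (A *m B) i j = A i 0 * B 0 j + A i 1 * B 1 j.
Proof.
rewrite mxE !big_ord_recl big_ord0 addr0.
by have -> : lift ord0 ord0 = 1 :> 'I_2 by apply/val_inj.
Qed.

Lemma det2E (R : comPzRingType) (A : 'M[R]_2) :
  \det A = A 0 0 * A 1 1 - A 0 1 * A 1 0.
Proof.
rewrite (expand_det_row _ 0) !big_ord_recl big_ord0 addr0 /cofactor !det_mx11.
rewrite !mxE /= expr0 mul1r expr1 mulN1r mulrN.
have -> : lift 0 0 = 1 :> 'I_2 by apply/val_inj.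
by congr (_ * _ - _ * A _ _); apply/val_inj.
Qed.

Definition mx2 (R : Type) (a b c d : R) : 'M[R]_2 :=
  \matrix_(i, j) if i == 0 then if j == 0 then a else b
                 else if j == 0 then c else d.

Lemma mx2E (R : Type) (a b c d : R) : let M := mx2 a b c d in
  (M 0 0 = a) * (M 0 1 = b) * (M 1 0 = c) * (M 1 1 = d).
Proof. by rewrite /= !mxE. Qed.

Lemma mx2P (R : Type) (A B : 'M[R]_2) :
  A 0 0 = B 0 0 -> A 0 1 = B 0 1 -> A 1 0 = B 1 0 -> A 1 1 = B 1 1 -> A = B.
Proof.
by move=> *; apply/matrixP=> i j; case: (ord2P i) => ->; case: (ord2P j) => ->.
Qed.

Lemma diag1E (R : comNzRingType) (u : R) : diag1 u = mx2 1 0 0 u.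
Proof. by apply: mx2P; rewrite mx2E !mxE ?mulr1n ?mulr0n. Qed.

Lemma map_diag1 (R S : comNzRingType) (f : {rmorphism R -> S}) (u : R) :
  map_mx f (diag1 u) = diag1 (f u).
Proof. by rewrite !diag1E; apply: mx2P; rewrite !mxE ?rmorph0 ?rmorph1. Qed.

Lemma polyX_dvd_coef0 (R : nzRingType) (p : {poly R}) :
  p`_0 = 0 -> exists q, p = q * 'X.
Proof.
rewrite -horner_coef0 => /eqP/factor_theorem[q ->].
by exists q; rewrite subr0.
Qed.

(** * Images of P in the two factors *)

Lemma in_PgrpE (A : SL2Zt) : (A \in in_Pgrp) = ((SL_mx A 1 0)`_0 == 0).
Proof.
rewrite unfold_in /in_Pgrp unfold_in /GammaQ mxE -['X]subr0 dvdp_XsubCl.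
by rewrite /root horner_coef0 coef_map intr_eq0.
Qed.

Lemma im_j1 (A : SL2Zt) : (SL_mx A 1 0)`_0 = 0 -> exists p, A = j1 p.
Proof. by move/eqP; rewrite -in_PgrpE => PA; exists (MkPgrp PA). Qed.

(** Conjugation by diag(1,t) divides the top right entry by t and multiplies the bottom left one by
    t, which gives a matrix of P. *)
Lemma im_j2 (A : SL2Zt) : (SL_mx A 0 1)`_0 = 0 -> exists p, A = j2 p.
Proof.
case/polyX_dvd_coef0=> q Aq.
pose B := mx2 (SL_mx A 0 0) q (SL_mx A 1 0 * 'X) (SL_mx A 1 1).
have detB : \det B == 1.
  by rewrite -(SL_det A) !det2E Aq !mx2E; apply/eqP; ring.
have PB : MkSL detB \in in_Pgrp by rewrite in_PgrpE mx2E coefMX.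
have AB : diag1 'X *m A = B *m diag1 'X.
  by rewrite diag1E; apply: mx2P; rewrite !mulmx2E !mx2E ?Aq; ring.
exists (MkPgrp PB); apply: i1_inj; rewrite j2E.
rewrite -[LHS](SL_conjK (laurent_tVr int) (laurent_tVl int)); congr SL_conj.
apply/val_inj; rewrite /= -map_diag1 -map_mxM AB map_mxM -mulmxA map_diag1.
by rewrite diag1M laurent_tVr diag1_1 mulmx1.
Qed.

(** * Injectivity: ping-pong on column vectors *)

Local Notation lp := (map_mx (@laurent_poly int)).
Local Notation T := (laurent_t int).

Lemma lp_inj m n : injective (fun A : 'M[{poly int}]_(m, n) => lp A).
Proof.
move=> A B /matrixP AB; apply/matrixP=> i j; apply: laurent_poly_inj.
by have:= AB i j; rewrite !mxE.
Qed.

(* For u = t^-k p with p a vector of polynomials: [in_X k u] says that the t-adic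
   valuation of u is -k and is attained by the top entry only, [in_Y k u] that
   the bottom entry of u has valuation -k, the least possible. *)
Definition in_X k (u : 'cV[laurent int]_2) : Prop :=
  exists2 p : 'cV[{poly int}]_2, lp p = T ^+ k *: u
    & (p 0 0)`_0 != 0 /\ (p 1 0)`_0 = 0.

Definition in_Y k (u : 'cV[laurent int]_2) : Prop :=
  exists2 p : 'cV[{poly int}]_2, lp p = T ^+ k *: u & (p 1 0)`_0 != 0.

(** At t = 0 the new bottom entry is the bottom left entry of [A] times the top entry of [p], both
    nonzero. *)
Lemma pingpong_i1 (A : SL2Zt) k u : ~ (exists p, A = j1 p) ->
  in_X k u -> in_Y k (i1 A *m u).
Proof.
move=> nA [p pu [p0 p1]]; exists (SL_mx A *m p).
  by rewrite map_mxM pu scalemxAr.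
rewrite mulmx2E coefD !coef0M p1 mulr0 addr0 mulf_neq0 //.
by apply/eqP => /im_j1.
Qed.

Lemma pingpong_i2 (A : SL2Zt) k u : ~ (exists p, A = j2 p) ->
  in_Y k u -> in_X k.+1 (i2 A *m u).
Proof.
move=> nA [p pu p1].
(* With D = diag(1,t), [E] is t D^-1, so D A E is t times [i2 A]: this factor t raises k by one. *)
pose E := mx2 'X 0 0 1 : 'M[{poly int}]_2.
exists (diag1 'X *m SL_mx A *m E *m p).
  have TE : lp E = T *: diag1 (laurent_tV int).
    apply: mx2P; rewrite diag1E !mxE /= ?mulr1 ?mulr0 ?rmorph0 //.
    by rewrite laurent_tVr rmorph1.
  rewrite !map_mxM pu TE map_diag1 -scalemxAr exprSr -scalerA.
  by rewrite -scalemxAr -scalemxAl.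
rewrite diag1E !mulmx2E !mx2E; split; last first.
  by rewrite !(mul0r, mulr0, addr0, add0r, mulr1) coefD !coef0M coefX !mul0r addr0.
rewrite !(mul0r, mulr0, addr0, add0r, mulr1, mul1r) coefD !coef0M coefX mulr0 mul0r.
by rewrite add0r mulf_neq0 //; apply/eqP => /im_j2.
Qed.

(* The case k = 0 occurs only for one-letter words in the first factor; the
   condition on u then keeps u from being fixed. *)
Lemma pingpong l w : reduced j1 j2 (l :: w) ->
  exists k (u : 'cV[{poly int}]_2), let v := word_eval i1 i2 (l :: w) *m lp u in
  if is_inl l then in_Y k v /\ ((0 < k)%N \/ (u 1 0)`_0 = 0)
  else in_X k v /\ (0 < k)%N.
Proof.
elim: w l => [|l' w IH] l [nl alt rw].
  pose e1 : 'cV[{poly int}]_2 := delta_mx 0 0.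
  pose e2 : 'cV[{poly int}]_2 := delta_mx 1 0.
  have e1X : in_X 0 (lp e1).
    by exists e1; rewrite ?expr0 ?scale1r // !mxE coef1 coef0.
  have e2Y : in_Y 0 (lp e2).
    by exists e2; rewrite ?expr0 ?scale1r // !mxE coef1.
  case: l nl alt => [a|b] /= nl _.
    exists 0, e1; split; last by right; rewrite !mxE coef0.
    by rewrite mulmx1; apply: pingpong_i1.
  exists 1, e2; split=> //.
  by rewrite mulmx1; apply: pingpong_i2.
have [k [u]] := IH _ rw; case: l l' nl alt rw => [a|b] [a'|b'] //= nl _ _.
  case=> vX k0; exists k, u; split; last by left.
  by rewrite -mulmxA; apply: pingpong_i1.
case=> vY _; exists k.+1, u; split=> //.
by rewrite -mulmxA; apply: pingpong_i2.
Qed.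

(** A trivial word would fix the polynomial vector [u], so that [p] = t^k u. For k > 0 this vanishes
    at t = 0; for k = 0 its bottom entry does. *)
Lemma reduced_word_eval_neq1 l w : reduced j1 j2 (l :: w) ->
  word_eval i1 i2 (l :: w) <> 1%g.
Proof.
case/pingpong => k [u] /[swap] -> /=; rewrite mul1mx.
have lpX p j : lp p = T ^+ j *: lp u -> p = 'X^j *: u.
  by rewrite -rmorphXn -map_mxZ => /lp_inj.
have lpX0 p j i : (0 < j)%N -> lp p = T ^+ j *: lp u -> (p i 0)`_0 = 0.
  by move=> j0 /lpX ->; rewrite mxE coef0M coefXn ltn_eqF ?mul0r.
case: (is_inl l) => [[[p pu p1] [k0|u1]]|[[p pu [p0 _]] k0]].
- by rewrite (lpX0 p k) ?eqxx in p1.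
- by move: p1; rewrite (lpX _ _ pu) mxE coef0M u1 mulr0 eqxx.
- by rewrite (lpX0 p k) ?eqxx in p0.
Qed.

(** * Surjectivity: descent on the denominator *)

(* The bottom row is the primitive vector proportional to (-b, a). *)
Lemma bezout_SL2 (a b : int) : (a != 0) || (b != 0) ->
  exists (S : SL 2 int) (g : int),
    [/\ g != 0, g * SL_mx S 1 0 = - b & g * SL_mx S 1 1 = a].
Proof.
rewrite -negb_and -gcdz_eq0 => ab.
pose c := (a %/ gcdz a b)%Z; pose d := (b %/ gcdz a b)%Z.
have ac : c * gcdz a b = a by rewrite divzK ?dvdz_gcdl.
have bd : d * gcdz a b = b by rewrite divzK ?dvdz_gcdr.
have [u [v uv]] := Bezoutz a b.
have uv1 : u * c + v * d = 1.
  by apply: (mulIf ab); rewrite mulrDl -!mulrA ac bd mul1r.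
have detS : \det (mx2 u v (- d) c) == 1.
  by rewrite det2E !mx2E -uv1; apply/eqP; ring.
exists (MkSL detS), (gcdz a b); rewrite /= !mx2E; split=> //.
  by rewrite -[in RHS]bd; ring.
by rewrite -[RHS]ac; ring.
Qed.

(** A row orthogonal to one nonzero column kills the other too, as the columns are proportional over
    Q. *)
Lemma SL2Z_kill_row (N : 'M[int]_2) : \det N = 0 ->
  exists S : SL 2 int, forall j, (SL_mx S *m N) 1 j = 0.
Proof.
rewrite det2E => /eqP; rewrite subr_eq0 => /eqP dN.
have [N0|] := boolP ((N 0 0 != 0) || (N 1 0 != 0)).
  have [S [g [g0 S0 S1]]] := bezout_SL2 N0; exists S => j.
  apply: (mulfI g0); rewrite mulmx2E mulr0 mulrDr !mulrA S0 S1.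
  by case: (ord2P j) => ->; rewrite ?dN; ring.
rewrite negb_or !negbK => /andP[/eqP N00 /eqP N10].
have [N1|] := boolP ((N 0 1 != 0) || (N 1 1 != 0)).
  have [S [g [g0 S0 S1]]] := bezout_SL2 N1; exists S => j.
  apply: (mulfI g0); rewrite mulmx2E mulr0 mulrDr !mulrA S0 S1.
  by case: (ord2P j) => ->; rewrite ?N00 ?N10; ring.
rewrite negb_or !negbK => /andP[/eqP N01 /eqP N11].
exists 1%g => j; rewrite mulmx2E.
by case: (ord2P j) => ->; rewrite ?N00 ?N10 ?N01 ?N11; ring.
Qed.

Lemma SL2Zt_factor_bottom (G : 'M[{poly int}]_2) : (\det G)`_0 = 0 ->
  exists (S : SL2Zt) H, SL_mx S *m G = diag1 'X *m H.
Proof.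
move=> dG; pose N := map_mx (horner_eval 0) G.
have /SL2Z_kill_row[S SN] : \det N = 0.
  by rewrite det_map_mx /= /horner_eval horner_coef0.
exists (SL_map polyC S); pose M := SL_mx (SL_map polyC S) *m G.
have M1 j : (M 1 j)`_0 = 0.
  rewrite -[RHS](SN j) !mulmx2E !mxE /= /horner_eval coefD !coefCM.
  by rewrite !horner_coef0.
have [p Mp] := polyX_dvd_coef0 (M1 0); have [q Mq] := polyX_dvd_coef0 (M1 1).
exists (mx2 (M 0 0) (M 0 1) p q); rewrite -/M; clearbody M.
by apply: mx2P; rewrite diag1E mulmx2E !mx2E ?Mp ?Mq; ring.
Qed.

(* Swap the rows with the Weyl element after killing the bottom one. *)
Lemma SL2Zt_factor_top (G : 'M[{poly int}]_2) : (\det G)`_0 = 0 ->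
  exists (S : SL2Zt) H, SL_mx S *m G = mx2 'X 0 0 1 *m H.
Proof.
case/SL2Zt_factor_bottom=> S [H SH].
have detW : \det (mx2 0 1 (-1) 0 : 'M[{poly int}]_2) == 1.
  by rewrite det2E !mx2E; apply/eqP; ring.
exists (MkSL detW * S)%g, (mx2 0 1 (-1) 0 *m H); rewrite /= -mulmxA SH.
by apply: mx2P; rewrite diag1E !mulmx2E !mx2E; ring.
Qed.

Lemma laurent_denominator (x : laurent int) :
  exists k p, laurent_poly p = T ^+ k * x.
Proof.
have /asboolP[p [k xp]] := valP x; exists k, p; apply/val_inj.
rewrite [RHS](rmorphM val) [X in X * _](rmorphXn val k) /= xp mulrC divfK //.
by rewrite expf_neq0 ?tofracX_neq0.
Qed.

Lemma laurent_mx_denominator m n (M : 'M[laurent int]_(m, n)) :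
  exists k G, lp G = T ^+ k *: M.
Proof.
have /choice[K /choice[G KG]] : forall ij, exists k p,
  laurent_poly p = T ^+ k * M ij.1 ij.2 by move=> ij; apply: laurent_denominator.
(* The sum serves only as a common upper bound of the exponents. *)
pose k := (\sum_ij K ij)%N; exists k.
exists (\matrix_(i, j) ('X^(k - K (i, j)) * G (i, j))).
apply/matrixP=> i j; rewrite !mxE rmorphM rmorphXn /= (KG (i, j)).
rewrite mulrA -exprD subnK //.
by rewrite /k (bigD1 (i, j)) //= leq_addr.
Qed.

Lemma det_laurent_mx (g : SL2Ztt) G k :
  lp G = T ^+ k *: SL_mx g -> \det G = 'X^(k + k).
Proof.
move=> Gg; apply: (@laurent_poly_inj int).
by rewrite -det_map_mx Gg detZ SL_det mulr1 -exprM muln2 addnn rmorphXn.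
Qed.

Lemma word_eval_surj (g : SL2Ztt) : exists w, word_eval i1 i2 w = g.
Proof.
have [k [G]] := laurent_mx_denominator (SL_mx g).
elim: k => [|k IH] in g G *.
  rewrite expr0 scale1r => Gg.
  have detG : \det G == 1 by rewrite (@det_laurent_mx g G 0) ?scale1r.
  by exists [:: inl (MkSL detG)]; rewrite /= mulg1; apply/val_inj.
move=> Gg; have dG := det_laurent_mx Gg.
have [|S1 [G1 SG1]] := @SL2Zt_factor_bottom G.
  by rewrite dG coefXn.
have [|S2 [G2 SG2]] := @SL2Zt_factor_top G1.
  (* Splitting off diag(1,t) lowers the determinant from t^(2k+2) to t^(2k+1), which still vanishes
     at t = 0. *)
  have : 'X * \det G1 = 'X * 'X^(k + k.+1).
    by rewrite -[X in X * _]det_diag1 -det_mulmx -SG1 det_mulmx SL_det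
      mul1r dG exprS.
  by move/(mulfI (negbT (polyX_eq0 _))) ->; rewrite coefXn addnS.
(* If D = diag(1,t) and E = diag(t,1), so that D E = t, then
   (D S2 D^-1) S1 g = t^-(k+1) D S2 G1 = t^-(k+1) D E G2 = t^-k G2. *)
have [|w wE] := IH (i2 S2 * i1 S1 * g)%g G2; last first.
  exists (inl S1^-1%g :: inr S2^-1%g :: w); rewrite /= wE.
  by rewrite -mulgA (multiplicativeVK i2) (multiplicativeVK i1).
(* As t is a unit, the identity for [G2] may be checked after multiplication by t, where t^(k+1) g
   becomes [G]. *)
have TI : injective (fun M : 'M[laurent int]_2 => T *: M).
  apply: (@can_inj _ _ _ (fun M => laurent_tV int *: M)) => M.
  by rewrite scalerA laurent_tVl scale1r.
apply: TI; rewrite scalerA -exprS /= -!mulmxA !scalemxAr -Gg -map_mxM SG1.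
rewrite map_mxM map_diag1 [diag1 (laurent_tV _) *m _]mulmxA diag1M laurent_tVl.
rewrite diag1_1 mul1mx -map_mxM SG2 map_mxM mulmxA -[diag1 T]map_diag1 -map_mxM.
rewrite -map_mxZ -map_mxM; congr (map_mx _ _).
by apply: mx2P; rewrite diag1E !mulmx2E !mx2E !mxE; ring.
Qed.

Theorem proposition2p1 :
  bijective
    (amalg_lift ij_comm : {multiplicative amalg j1 j2 -> SL 2 (laurent int)}).
Proof.
have inj : injective (amalg_lift ij_comm).
  apply: amalg_lift_inj reduced_word_eval_neq1.
  exact: inj_comp i1_inj j1_inj.
have surj g : exists x, amalg_lift ij_comm x = g.
  have [w <-] := word_eval_surj g.
  by exists (amalg_pi j1 j2 w); rewrite amalg_lift_pi.
have [h hK] := choice surj.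
by exists h => // x; apply: inj; rewrite hK.
Qed.
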